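(* Let $n\ge1$ and let $X\subseteq2^{\mathbb{Z}}$ be an infinite subshift of symbolic rank $n$. Then the following are equivalent: (1) $X$ is minimal. (2) There exists a rank-$n$ word $V$ such that $X=X_V$ and $V$ has a proper rank-$n$ construction with bounded spacer parameter. (3) For any rank-$n$ word $V$ such that $X=X_V$, $V$ has a proper rank-$n$ construction with bounded spacer parameter.
   Context: $2^{\mathbb{Z}}=\{0,1\}^{\mathbb{Z}}$ has the product topology, $\sigma(x)(n)=x(n+1)$. A subshift is a closed set $X\subseteq 2^{\mathbb{Z}}$ with $\sigma X=X$; it is minimal if every orbit $\{\sigma^kx:k\in\mathbb{Z}\}$ is dense in $X$. For an infinite word $V\in\{0,1\}^{\mathbb{N}}$, $X_V=\{x\in 2^{\mathbb{Z}}:$ every finite subword of $x$ is a subword of $V\}$. Let $\mathcal{F}$ be the set of finite $0,1$-words that begin and end with $0$. For finite $S\subseteq\mathcal{F}$ and $w\in\mathcal{F}$, a building of $w$ from $S$ consists of $v_1,\dots,v_{k+1}\in S$ and nonnegative integers $s_1,\dots,s_k$ (its spacer parameter), $k\ge 1$, with $w=v_1 1^{s_1}v_2\cdots v_k1^{s_k}v_{k+1}$; then $w$ is built from $S$ starting with $v_1$. Every word of $S$ is used in the building if $\{v_1,\dots,v_{k+1}\}=S$. For $n\ge1$, a rank-$n$ generating sequence is a family $\{v_{i,j}\}_{i\ge0,1\le j\le n_i}$ of finite words such that for all $i\ge 0$: $n_i\le n$; $v_{0,j}=0$ for all $1\le j\le n_0$; $v_{i+1,1}$ is built from $S_i=\{v_{i,1},\dots,v_{i,n_i}\}$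 starting with $v_{i,1}$; and $v_{i+1,j}$ is built from $S_i$ for all $2\le j\le n_{i+1}$. A rank-$n$ construction is such a sequence together with one chosen building of each $v_{i+1,j}$ from $S_i$ (that of $v_{i+1,1}$ starting with $v_{i,1}$); it is a construction of the infinite word $V=\lim_i v_{i,1}$. It is proper if for all $i\ge0$, $n_i=n$ and for all $1\le j\le n$ every word of $S_i$ is used in the building of $v_{i+1,j}$. It has bounded spacer parameter if there is $M>0$ such that all the integers $s_1,\dots,s_k$ in all of its buildings are $\le M$. $V$ is a rank-$n$ word if it has a rank-$n$ construction but not a rank-$(n-1)$ construction. A subshift $X$ has symbolic rank $n$ if $n$ is the smallest positive integer such that $X=X_V$ for some $V$ having a rank-$n$ construction. *)

(* Defs.v *)
From mathcomp Require Import all_boot all_order all_algebra.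
From mathcomp Require Import boolp classical_sets functions cardinality.
From mathcomp Require Import filter topology.

Set Implicit Arguments.
Unset Strict Implicit.
Unset Printing Implicit Defensive.

Local Open Scope classical_set_scope.

(* The letter 0 is false and the letter 1 is true. *)
Definition word := seq bool.

(* The topology of bool being discrete, this is 2^Z with its product topology. *)
Notation full_shift := (prod_topology (fun _ : int => bool)).

Definition shift (x : full_shift) : full_shift := fun n : int => x (n + 1)%R.

Definition shift_pow (k : int) (x : full_shift) : full_shift :=
  fun n : int => x (n + k)%R.

Definition shift_orbit (x : full_shift) : set full_shift :=
  [set shift_pow k x | k in [set: int]].

Definition subshift (X : set full_shift) : Prop :=
  closed X /\ shift @` X = X.

Definition minimal_subshift (X : set full_shift) : Prop :=
  forall x, X x -> X `<=` closure (shift_orbit x).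

Definition subword_biinf (u : word) (x : full_shift) : Prop :=
  exists a : int, u = mkseq (fun k => x (a + k%:Z)%R) (size u).

Definition subword_inf (u : word) (V : nat -> bool) : Prop :=
  exists a : nat, u = mkseq (fun k => V (a + k)%N) (size u).

Definition word_subshift (V : nat -> bool) : set full_shift :=
  [set x | forall u : word, subword_biinf u x -> subword_inf u V].

Definition in_F (w : word) : bool :=
  [&& w != [::], ~~ head true w & ~~ last true w].

(* v_1 1^{s_1} v_2 ... 1^{s_k} v_{k+1} is recorded as the pair
   (v_1, [:: (s_1, v_2); ...; (s_k, v_{k+1})]). *)
Definition building : Type := (word * seq (nat * word))%type.

Definition building_value (b : building) : word :=
  b.1 ++ flatten [seq nseq p.1 true ++ p.2 | p <- b.2].

Definition building_words (b : building) : seq word :=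
  b.1 :: [seq p.2 | p <- b.2].

Definition building_spacers (b : building) : seq nat := [seq p.1 | p <- b.2].

(* The sequence S stands for the finite set of its elements. *)
Definition is_building (S : seq word) (w : word) (b : building) : Prop :=
  [/\ all in_F S, in_F w, b.2 != [::], {subset building_words b <= S}
    & w = building_value b].

(* The words v_{i,j} and the building of v_{i+1,j} from S_i. Only the indices
   1 <= j <= n_i (resp. 1 <= j <= n_{i+1}) are meaningful. *)
Record construction := Construction {
  cnum : nat -> nat;
  cword : nat -> nat -> word;
  cbuild : nat -> nat -> building }.

Definition level (C : construction) (i : nat) : seq word :=
  [seq cword C i j | j <- iota 1 (cnum C i)].

(* 1 <= n_i since v_{i,1} exists at every stage; in particular there is no
   rank-0 construction. *)
Definition rank_construction (n : nat) (C : construction) : Prop :=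
  [/\ forall i, 1 <= cnum C i <= n,
      forall j, 1 <= j <= cnum C 0 -> cword C 0 j = [:: false],
      forall i j, 1 <= j <= cnum C i.+1 ->
        is_building (level C i) (cword C i.+1 j) (cbuild C i j)
    & forall i, (cbuild C i 1).1 = cword C i 1].

(* V is the letterwise limit of the words v_{i,1}. *)
Definition construction_of (C : construction) (V : nat -> bool) : Prop :=
  forall m, \forall i \near \oo, onth (cword C i 1) m = Some (V m).

Definition has_rank_construction (n : nat) (V : nat -> bool) : Prop :=
  exists2 C, rank_construction n C & construction_of C V.

Definition proper_construction (n : nat) (C : construction) : Prop :=
  (forall i, cnum C i = n) /\
  forall i j, 1 <= j <= n -> building_words (cbuild C i j) =i level C i.

Definition bounded_spacers (C : construction) : Prop :=
  exists2 M, 0 < M & forall i j, 1 <= j <= cnum C i.+1 ->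
    all (fun s => s <= M) (building_spacers (cbuild C i j)).

Definition has_proper_bounded_construction (n : nat) (V : nat -> bool) : Prop :=
  exists C, [/\ rank_construction n C, construction_of C V,
    proper_construction n C & bounded_spacers C].

Definition rank_word (n : nat) (V : nat -> bool) : Prop :=
  has_rank_construction n V /\ ~ has_rank_construction n.-1 V.

Definition realized_in_rank (n : nat) (X : set full_shift) : Prop :=
  exists2 V, has_rank_construction n V & X = word_subshift V.

Definition symbolic_rank (X : set full_shift) (n : nat) : Prop :=
  [/\ 0 < n, realized_in_rank n X
    & forall m, 0 < m -> realized_in_rank m X -> n <= m].

(* Main.v *)
(* If V has a proper construction with bounded spacers, every word of V occurs
   in all the words of some level, and V is a concatenation of words of that
   level with bounded spacers; so every word of V occurs with bounded gaps, and
   X_V is minimal.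

   Conversely, let X_V be minimal, infinite and of symbolic rank n, and discard
   the words v_{i,j} that are used in no v_{k,1}. Spacers are bounded since
   otherwise the fixed point 1^oo lies in X_V. If some word u of level i is
   avoided by some word at each later level, then the words avoiding u are built
   from one another and are fewer than n at high levels; by Konig's lemma they
   yield a rank-(n-1) construction of a word W whose subshift is nonempty and
   contained in X_V, hence equal to it, contradicting the symbolic rank. So
   every word of level i is used in all the words of some later level, and
   keeping only suitable levels makes the construction proper. *)

Require Import Defs.
From mathcomp Require Import all_boot all_algebra.
From mathcomp Require Import boolp classical_sets functions cardinality.
From mathcomp Require Import filter topology.
From mathcomp Require Import zify.

Set Implicit Arguments.
Unset Strict Implicit.
Unset Printing Implicit Defensive.

Local Open Scope classical_set_scope.

(** * Subwords of finite and infinite words *)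

Lemma infix_mkseq (u : word) (f : nat -> bool) m :
  infix u (mkseq f m) ->
  exists2 p, p + size u <= m & u = mkseq (fun k => f (p + k)) (size u).
Proof.
move=> /infixP [s1 [s2 E]]; exists (size s1).
  have := congr1 size E; rewrite size_mkseq !size_cat => ->.
  by rewrite addnA leq_addr.
apply: (@eq_from_nth _ false); rewrite ?size_mkseq // => k ku.
have km : size s1 + k < m.
  have := congr1 size E; rewrite size_mkseq !size_cat => ->.
  by rewrite addnA ltn_addr // ltn_add2l.
rewrite nth_mkseq // -(nth_mkseq false f km) E nth_cat ltnNge leq_addr /= addKn.
by rewrite nth_cat ku.
Qed.

Lemma mkseq_infix (f : nat -> bool) p q m : p + q <= m ->
  infix (mkseq (fun k => f (p + k)) q) (mkseq f m).
Proof.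
move=> le; apply/infixP; exists (mkseq f p), (drop (p + q) (mkseq f m)).
apply: (@eq_from_nth _ false) => [|k]; rewrite ?size_cat ?size_drop ?size_mkseq.
  by rewrite addnA subnKC.
move=> km; rewrite !nth_cat !size_mkseq nth_mkseq //.
case: ltnP => [kp|pk]; first by rewrite nth_mkseq.
case: ltnP => [kq|qk]; first by rewrite nth_mkseq // subnKC.
rewrite nth_drop nth_mkseq; last by lia.
by congr f; lia.
Qed.

Lemma subword_infP u V : subword_inf u V <-> exists m, infix u (mkseq V m).
Proof.
split=> [[a ->]|[m /infix_mkseq [p _ ->]]].
  by exists (a + size u); apply: mkseq_infix.
by exists p; rewrite !size_mkseq.
Qed.

Lemma infix_subword_inf u v V : infix u v -> subword_inf v V -> subword_inf u V.
Proof.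
move=> uv /subword_infP [m vm]; apply/subword_infP; exists m.
exact: infix_trans uv vm.
Qed.

Lemma infix_subword_biinf u v x :
  infix u v -> subword_biinf v x -> subword_biinf u x.
Proof.
move=> uv [a Ev]; move: uv; rewrite Ev => /infix_mkseq [p _ ->].
exists (a + p%:Z)%R; rewrite !size_mkseq; apply: eq_mkseq => k.
by congr (x _); lia.
Qed.

(** * Topology of the full shift, and minimality in terms of subwords *)

Definition agree (N : nat) (x y : full_shift) : Prop :=
  forall k : int, (`|k| <= N)%N -> y k = x k.

(** A condition on one coordinate is implied by agreement on a large enough window, and a window is
    a finite intersection of conditions on one coordinate. *)
Lemma nbhs_agreeP (x : full_shift) (A : set full_shift) :
  nbhs x A <-> exists N, agree N x `<=` A.
Proof.
split.
- pose F : set_system full_shift := filter_from [set: nat] (fun N => agree N x).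
  have FF : Filter F.
    apply: filter_from_filter; first by exists 0.
    move=> i j _ _; exists (maxn i j) => // y xy; split=> k ki; apply: xy; lia.
  have : F --> x.
    apply/cvg_sup => i B [] _ [] [C _ <-] /= Cx CB.
    exists `|i|%N => // y xy; apply: CB; rewrite /= xy //.
  by move=> Fx /Fx [N _ NA]; exists N.
- move=> [N NA]; suff : nbhs x (agree N x) by apply: filterS.
  move=> {NA}.
  have h (i : int) : nbhs x [set y : full_shift | y i = x i].
    exact: (@proj_continuous int (fun=> bool) i x [set x i] (discrete_set1 _)).
  elim: N => [|N IH].
    by apply: filterS (h 0%R) => y /= yx k; rewrite leqn0 absz_eq0 => /eqP ->.
  apply: filterS (filterI IH (filterI (h (N.+1%:Z)%R) (h (- N.+1%:Z)%R))).
  move=> y [/= yN [y1 y2]] k kN.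
  have [kle|lt] := leqP `|k|%N N; first exact: yN.
  by have [-> | ->] : (k = N.+1%:Z \/ k = - N.+1%:Z)%R by lia.
Qed.

Lemma full_shift_compact : compact [set: full_shift].
Proof.
have := @tychonoff int (fun _ : int => _) _ (fun=> bool_compact).
by congr (compact _); rewrite eqEsubset.
Qed.

Lemma agree_subword N u x y a : agree N x y ->
  (`|a| + size u <= N)%N -> u = mkseq (fun k => x (a + k%:Z)%R) (size u) ->
  u = mkseq (fun k => y (a + k%:Z)%R) (size u).
Proof.
move=> xy aN Eu; rewrite {1}Eu; apply/eq_in_map => k.
by rewrite mem_iota => /andP [_ ku]; rewrite xy //; lia.
Qed.

(** The orbit of [x] enters the cylinder around [y] that is wide enough to hold the occurrence of
    [u]. *)
Lemma minimal_subword X x y u : minimal_subshift X -> X x -> X y ->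
  subword_biinf u y -> subword_biinf u x.
Proof.
move=> mX Xx Xy [a Eu].
have ynb : nbhs y (agree (`|a| + size u)%N y).
  by apply/nbhs_agreeP; exists (`|a| + size u)%N.
have [_ [[k _ <-] yz]] := mX _ Xx _ Xy _ ynb.
have Ea := agree_subword yz (leqnn _) Eu; exists (a + k)%R; rewrite {1}Ea.
by apply: eq_mkseq => j; rewrite /shift_pow; congr (x _); lia.
Qed.

(** To approach [y] up to radius [N], find its central window of length [2N+1] in [x] and recentre
    that occurrence by a shift. *)
Lemma subword_minimal (X : set full_shift) :
  (forall x y u, X x -> X y -> subword_biinf u y -> subword_biinf u x) ->
  minimal_subshift X.
Proof.
move=> H x Xx y Xy A /nbhs_agreeP [N NA].
have [] := H x y (mkseq (fun k => y (- N%:Z + k%:Z)%R) N.*2.+1) Xx Xy.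
  by exists (- N%:Z)%R; rewrite !size_mkseq.
move=> a; rewrite size_mkseq => E; exists (shift_pow (a + N%:Z)%R x).
split; first by exists (a + N%:Z)%R.
apply: NA => k kN; have := congr1 (nth false ^~ (absz (k + N%:Z)%R)) E.
rewrite !nth_mkseq; try lia.
have -> : Posz (absz (k + N%:Z)%R) = (k + N%:Z)%R by lia.
rewrite /shift_pow => Ek.
have -> : y k = y (- N%:Z + (k + N%:Z))%R by congr (y _); lia.
by rewrite Ek; congr (x _); lia.
Qed.

(** By compactness, the translates of [V] whose origin is at position [m] have a cluster point as
    [m] grows. *)
Lemma word_subshift_nonempty V : exists x, word_subshift V x.
Proof.
(* Left of [-m] the absolute value gives arbitrary letters; below, [|a| <= m] keeps the occurrence
   of [u] at or after [-m]. *)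
pose xs (m : nat) : full_shift := fun a => V (absz (a + m%:Z)%R).
have [|x [_ xcl]] := @full_shift_compact (xs @ \oo) _; first exact: filterT.
exists x => u [a Eu].
have xnb : nbhs x (agree (`|a| + size u)%N x).
  by apply/nbhs_agreeP; exists (`|a| + size u)%N.
have Fm : (xs @ \oo) [set xs m | m in [set m | (`|a| <= m)%N]].
  by exists `|a|%N => // m am /=; exists m.
have [_ [[m am <-] xz]] := xcl _ _ Fm xnb.
have Ea := agree_subword xz (leqnn _) Eu.
exists (absz (a + m%:Z)%R); rewrite {1}Ea.
by apply: eq_mkseq => k; rewrite /xs; congr V; move: am => /=; lia.
Qed.

(** * Buildings and their composition *)

Lemma building_word_infix b v :
  v \in building_words b -> infix v (building_value b).
Proof.
case: b => w l; rewrite /building_words /building_value /= inE.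
case/orP => [/eqP ->|]; first exact: prefix_infix.
move=> vl; apply: infix_catl.
elim: l vl => //= p l IH; rewrite inE => /orP [/eqP ->|/IH vl].
  by apply: infix_catr; apply: suffix_infix.
exact: infix_catl.
Qed.

Lemma building_spacer_infix b s :
  s \in building_spacers b -> infix (nseq s true) (building_value b).
Proof.
case: b => w l; rewrite /building_spacers /building_value /= => sl.
apply: infix_catl; elim: l sl => //= p l IH; rewrite inE.
case/orP => [/eqP ->|/IH]; last exact: infix_catl.
by rewrite -catA; apply: prefix_infix.
Qed.

(** Every word of [b] is replaced by its own building; the spacer in front of it passes to the first
    word of the replacement. *)
Definition building_comp (b : building) (h : word -> building) : building :=
  ((h b.1).1,
   (h b.1).2 ++ flatten [seq (p.1, (h p.2).1) :: (h p.2).2 | p <- b.2]).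

Lemma building_words_comp b h : building_words (building_comp b h) =
  flatten [seq building_words (h v) | v <- building_words b].
Proof.
case: b => w l; rewrite /building_words /= map_cat; congr (_ :: _ ++ _).
by elim: l => //= p l IH; rewrite map_cat IH.
Qed.

Lemma building_value_comp b h :
  {in building_words b, forall v, building_value (h v) = v} ->
  building_value (building_comp b h) = building_value b.
Proof.
case: b => w l; rewrite /building_value /= => H.
rewrite map_cat flatten_cat catA; have -> := H w; rewrite ?mem_head //.
congr (_ ++ _); have {H} : {in map snd l, forall v, building_value (h v) = v}.
  by move=> v vl; apply: H; rewrite inE vl orbT.
elim: l => //= p l IH H; rewrite map_cat flatten_cat IH => [|v vl].
  rewrite -[X in _ = (_ ++ X) ++ _](H p.2) ?mem_head //.
  by rewrite /building_value !catA.
by apply: H; rewrite inE vl orbT.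
Qed.

Lemma building_spacers_comp (P : pred nat) b h :
  all P (building_spacers b) ->
  {in building_words b, forall v, all P (building_spacers (h v))} ->
  all P (building_spacers (building_comp b h)).
Proof.
case: b => w l; rewrite /building_spacers /= => Pl H.
rewrite map_cat all_cat H ?mem_head //=.
have {H} : {in map snd l, forall v, all P (building_spacers (h v))}.
  by move=> v vl; apply: H; rewrite inE vl orbT.
elim: l Pl => //= p l IH /andP [Pp Pl] H.
rewrite Pp map_cat all_cat (H p.2) ?mem_head //= IH // => v vl.
by apply: H; rewrite inE vl orbT.
Qed.

(** * Constructions as sequences of sets of words *)

(* A rank-[n] construction presented by its sets of words; the building of a
   word depends on the word only, not on its index, and [r i] is [v_{i,1}]. *)
Record scheme (n : nat) (S : nat -> seq word) (g : nat -> word -> building)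
    (r : nat -> word) : Prop := Scheme {
  scheme_size : forall i, size (S i) <= n;
  scheme_root : forall i, r i \in S i;
  scheme_zero : forall v, v \in S 0 -> v = [:: false];
  scheme_build : forall i v, v \in S i.+1 -> is_building (S i) v (g i v);
  scheme_first : forall i, (g i (r i.+1)).1 = r i }.

(** Equal words of one level may carry different buildings; [index] selects the first one. The [.+1]
    passes from positions counted from 0 to indices counted from 1. *)
Definition word_build (C : construction) (i : nat) (v : word) : building :=
  cbuild C i (index v (level C i.+1)).+1.

Lemma mem_levelP C i v : v \in level C i ->
  [/\ 1 <= (index v (level C i)).+1 <= cnum C i
    & cword C i (index v (level C i)).+1 = v].
Proof.
move=> vl; have lt : index v (level C i) < cnum C i.
  by move: vl; rewrite -index_mem size_map size_iota.
split=> //; rewrite -{2}(nth_index [::] vl) (nth_map 0) ?size_iota //.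
by rewrite nth_iota // add1n.
Qed.

Lemma mem_level C i j : 1 <= j <= cnum C i -> cword C i j \in level C i.
Proof. by move=> j1; apply: map_f; rewrite mem_iota; lia. Qed.

Lemma construction_scheme n C : rank_construction n C ->
  scheme n (level C) (word_build C) (cword C ^~ 1).
Proof.
move=> [nC C0 CS C1]; split=> [i|i|v vl|i v vl|i].
- by rewrite size_map size_iota; case/andP: (nC i).
- by apply: mem_level; rewrite leqnn; case/andP: (nC i).
- by have [j1 <-] := mem_levelP vl; apply: C0.
- have [j1 E] := mem_levelP vl; rewrite -[X in is_building _ X _]E.
  exact: CS.
- rewrite /word_build.
  (* The root is found at its own index 1, whose building is the one known to start with the
     previous root. *)
  suff -> : index (cword C i.+1 1) (level C i.+1) = 0 by [].
  rewrite /level; case: (cnum C i.+1) (nC i.+1) => // m _.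
  by rewrite /= eqxx.
Qed.

(** The root is moved to the front, and each level is padded with copies of its root up to the [n]
    entries that properness demands. *)
Lemma scheme_construction n S g r : scheme n S g r ->
  exists C, [/\ rank_construction n C, proper_construction n C <->
      (forall i v, v \in S i.+1 -> building_words (g i v) =i S i),
    forall i, cword C i 1 = r i &
    forall i j, 1 <= j <= cnum C i.+1 ->
      exists2 v, v \in S i.+1 & cbuild C i j = g i v].
Proof.
move=> [nS rS S0 SS S1].
pose T i := r i :: rem (r i) (S i).
have TS i : T i =i S i by move=> v; rewrite (perm_mem (perm_to_rem (rS i))).
have n0 : 0 < n by apply: leq_trans (nS 0); case: (S 0) (rS 0).
have sT i : size (T i) <= n.
  by rewrite -(perm_size (perm_to_rem (rS i))).
pose w i j := nth (r i) (T i) j.-1.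
have wS i j : w i j \in S i.
  rewrite -TS /w; have [lt|ge] := ltnP j.-1 (size (T i)); first exact: mem_nth.
  by rewrite nth_default // mem_head.
pose C := Construction (fun=> n) w (fun i j => g i (w i.+1 j)).
have CS i : level C i =i S i.
  move=> v; apply/mapP/idP => [[j _ ->]|]; first exact: wS.
  rewrite -TS => /(nthP (r i)) [k kT <-]; exists k.+1 => //.
  by rewrite mem_iota; apply: leq_trans kT (sT i).
exists C; split=> //.
- split=> [i|j _|i j _|i] /=; rewrite ?n0 ?leqnn //.
  + exact/S0/wS.
  + have [F wF b2 sub E] := SS _ _ (wS i.+1 j); split=> //.
      by apply/allP => v; rewrite CS => /(allP F).
    by move=> v /sub; rewrite CS.
- split=> [[_ H] i v vS|H].
    have [j jn <-] : exists2 j, 1 <= j <= n & w i.+1 j = v.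
      have : v \in T i.+1 by rewrite TS.
      case/(nthP (r i.+1)) => k kT <-; exists k.+1 => //.
      exact: leq_trans kT (sT i.+1).
    by move=> u; rewrite -CS; apply: H.
  by split=> // i j _ u; rewrite CS; apply: H.
- by move=> i j _; exists (w i.+1 j).
Qed.

(* The building over [S i] of a word [v] of [S (d + i)], for a scheme with
   buildings [g]. *)
Fixpoint expand (g : nat -> word -> building) (i d : nat) (v : word) :
    building :=
  if d is e.+1 then building_comp (g (e + i) v) (expand g i e) else (v, [::]).

Lemma mem_expandS g i d v u :
  u \in building_words (expand g i d.+1 v) <->
  exists2 p, p \in building_words (g (d + i) v) &
             u \in building_words (expand g i d p).
Proof.
rewrite building_words_comp; split=> [/flatten_mapP [p pv up]|[p pv up]].
  by exists p.
by apply/flatten_mapP; exists p.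
Qed.

(** [expand] unfolds from the top level; here the bottom level is split off instead. *)
Lemma mem_expandSr g i d v u :
  u \in building_words (expand g i d.+1 v) <->
  exists2 p, p \in building_words (expand g i.+1 d v) &
             u \in building_words (g i p).
Proof.
elim: d v => [|d IH] v.
  rewrite mem_expandS; split=> [[p pv]|[p]]; rewrite inE => /eqP ->.
    by exists v; rewrite ?mem_head.
  by exists u; rewrite ?mem_head.
rewrite mem_expandS.
split=> [[p pv /IH [q qp uq]]|[q /mem_expandS [p pv qp] uq]].
  by exists q => //; apply/mem_expandS; exists p => //; rewrite addnS.
by exists p; [rewrite addnS in pv | apply/IH; exists q].
Qed.

Definition limit_word (r : nat -> word) (V : nat -> bool) : Prop :=
  forall m, \forall i \near \oo, onth (r i) m = Some (V m).

Section Scheme.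

Variables (n : nat) (S : nat -> seq word) (g : nat -> word -> building).
Variable (r : nat -> word).
Hypothesis sch : scheme n S g r.

Lemma build_sub i v : v \in S i.+1 -> {subset building_words (g i v) <= S i}.
Proof. by case/(scheme_build sch). Qed.

Lemma build_value i v : v \in S i.+1 -> building_value (g i v) = v.
Proof. by case/(scheme_build sch). Qed.

Lemma scheme_in_F i v : v \in S i -> in_F v.
Proof.
case: i => [/(scheme_zero sch) -> //|i].
by case/(scheme_build sch).
Qed.

Lemma expand_sub i d v : v \in S (d + i) ->
  {subset building_words (expand g i d v) <= S i}.
Proof.
elim: d v => [|d IH] v vS u; first by rewrite inE => /eqP ->.
by case/mem_expandS => p /(build_sub vS) /IH; apply.
Qed.

Lemma expand_value i d v : v \in S (d + i) ->
  building_value (expand g i d v) = v.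
Proof.
elim: d v => [|d IH] v vS; first by rewrite /building_value cats0.
rewrite building_value_comp ?build_value // => p pv.
by apply: IH; apply: build_sub pv.
Qed.

Lemma expand_building i d v : 0 < d -> v \in S (d + i) ->
  is_building (S i) v (expand g i d v).
Proof.
case: d => // d _ vS; split.
- by apply/allP => u; apply: scheme_in_F.
- exact: scheme_in_F vS.
- have [_ _ + _ _] := scheme_build sch vS => /=.
  by case: (g _ v).2 => // p l _; case: (expand _ _ _ _).2.
- exact: expand_sub.
- by rewrite expand_value.
Qed.

Lemma expand_first i d : (expand g i d (r (d + i))).1 = r i.
Proof. by elim: d => //= d; rewrite (scheme_first sch). Qed.

Lemma expand_spacers (P : pred nat) :
  (forall i v, v \in S i.+1 -> all P (building_spacers (g i v))) ->
  forall i d v, v \in S (d + i) -> all P (building_spacers (expand g i d v)).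
Proof.
move=> H i; elim=> //= d IH v vS; apply: building_spacers_comp; first exact: H.
by move=> p pv; apply: IH; apply: build_sub pv.
Qed.

(** The building of a root starts with the previous root and has a further nonempty word, so the
    lengths of the roots strictly increase. *)
Lemma root_size i : i < size (r i).
Proof.
elim: i => [|i IH]; first by rewrite (scheme_zero sch (scheme_root sch 0)).
have [F _ b2 sub E] := scheme_build sch (scheme_root sch i.+1).
move: b2 sub E; rewrite /building_words /building_value (scheme_first sch).
case: (g i _).2 => // p l _ /= sub ->; rewrite !size_cat size_nseq.
have /(allP F) /and3P [p0 _ _] : p.2 \in S i.
  by apply: sub; rewrite in_cons; apply/orP; right; apply: mem_head.
have {}p0 : 0 < size p.2 by case: p.2 p0.
by rewrite -addn1 leq_add // addn_gt0 addn_gt0 p0 orbT.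
Qed.

Lemma root_prefix i d : prefix (r i) (r (d + i)).
Proof.
rewrite -[X in prefix _ X](expand_value (scheme_root sch (d + i))).
by rewrite /building_value expand_first prefix_prefix.
Qed.

Lemma scheme_limit : exists V, limit_word r V.
Proof.
exists (fun m => nth false (r m) m) => m; exists m => // i /= mi.
have /prefixP [s] := root_prefix m (i - m); rewrite subnK // => ->.
by rewrite onthE map_cat nth_cat size_map root_size (nth_map false) ?root_size.
Qed.

End Scheme.

(** * Windows in a concatenation of blocks *)

Lemma infix_take_mid (x v y : word) L : size x + size v <= L ->
  infix v (take L (x ++ v ++ y)).
Proof.
move=> le; rewrite catA take_cat size_cat ltnNge le /= -catA.
exact: infix_infix.
Qed.

(* [2 K + M] bounds a partial block, a spacer and the full block after it. *)
Lemma blocks_window (u : word) K M (l : seq (nat * word)) a :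
  all (fun p => [&& p.1 <= M, size p.2 <= K & infix u p.2]) l ->
  a + (K.*2 + M).+1 <= size (flatten [seq nseq p.1 true ++ p.2 | p <- l]) ->
  infix u
    (take (K.*2 + M).+1 (drop a (flatten [seq nseq p.1 true ++ p.2 | p <- l]))).
Proof.
elim: l a => [|[s v] l IH] a; first by rewrite addnS.
move=> /= /andP [/and3P [sM vK uv] Hl]; rewrite !size_cat size_nseq => aL.
rewrite drop_cat size_cat size_nseq.
case: ltnP => [asv|sva]; last by apply: IH => //; lia.
(* If the window starts at or before the end of the spacer, it contains the whole block [v]. *)
have [les|lts] := leqP a s.
  apply: infix_trans uv _; rewrite drop_cat size_nseq.
  have E : (if a < s then drop a (nseq s true) ++ v else drop (a - s) v)
           = nseq (s - a) true ++ v.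
    case: ltnP => [lt|ge]; first by rewrite drop_nseq.
    have -> : a = s by lia.
    by rewrite subnn drop0.
  rewrite E -catA; apply: infix_take_mid.
  by rewrite size_nseq; lia.
(* The window starts inside [v]; its length forces a next block, which it contains. *)
case: l Hl {IH} aL => [|[s' v'] l] /=; first by lia.
move=> /andP [/and3P [sM' vK' uv'] _] _.
apply: infix_trans uv' _; rewrite drop_cat size_nseq ltnNge (ltnW lts) /=.
rewrite -!catA catA; apply: infix_take_mid.
by rewrite size_cat size_drop size_nseq; lia.
Qed.

(** * Koenig's lemma *)

(** Call an element deep if it has a descendant at every later level. Since levels are finite,
    elements that are all not deep fail at one common depth; hence level 0 has a deep element, and
    each deep element has a deep child. *)
Lemma konig (A : eqType) (T : nat -> seq A) (f : nat -> A -> A) :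
  (forall d, T d != [::]) ->
  (forall d v, v \in T d.+1 -> f d v \in T d) ->
  exists t : nat -> A, forall d, t d \in T d /\ f d (t d.+1) = t d.
Proof.
move=> T0 Tf.
pose anc := fix anc d m v := if m is k.+1 then f d (anc d.+1 k v) else v.
have ancS d m v : anc d m.+1 v = anc d m (f (m + d) v).
  elim: m d v => [//|m IH] d v.
  by rewrite -[LHS]/(f d (anc d.+1 m.+1 v)) IH addnS.
have ancT d m v : v \in T (m + d) -> anc d m v \in T d.
  elim: m d v => //= m IH d v vT; apply: Tf; apply: IH.
  by rewrite addnS.
pose deep d v := forall m, exists2 w, w \in T (m + d) & anc d m w = v.
pose bad d v m := forall w, w \in T (m + d) -> anc d m w <> v.
have badD d v m k : bad d v m -> bad d v (k + m).
  move=> b; elim: k => // k IH w wT.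
  by rewrite addSn ancS; apply: IH; apply: Tf.
have deepT d v : deep d v -> v \in T d.
  by case/(_ 0) => w wT <-.
have allbad d (s : seq A) : {in s, forall a, ~ deep d a} ->
    exists m, {in s, forall a, bad d a m}.
  elim: s => [|a s IH] sd; first by exists 0.
  have [|m Hm] := IH; first by move=> v vs; apply: sd; rewrite inE vs orbT.
  have [k ak] : exists k, bad d a k.
    apply: contrapT => nb; apply: (sd a (mem_head _ _)) => k.
    apply: contrapT => nk; apply: nb; exists k => w wT wa.
    by apply: nk; exists w.
  exists (k + m) => v; rewrite inE => /orP [/eqP ->|/Hm]; last exact: badD.
  by rewrite addnC; apply: badD.
have deepS d v : deep d v -> exists2 v', deep d.+1 v' & f d v' = v.
  move=> dv; apply: contrapT => no.
  have [|m Hm] := allbad d.+1 [seq v' <- T d.+1 | f d v' == v].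
    move=> a; rewrite mem_filter => /andP [/eqP fa _] da.
    by apply: no; exists a.
  have [w wT wv] := dv m.+1; have wT' : w \in T (m + d.+1) by rewrite addnS.
  apply: (Hm (anc d.+1 m w) _ w wT' erefl).
  by rewrite mem_filter ancT // andbT; apply/eqP.
have [v0 v0d] : exists v0, deep 0 v0.
  apply: contrapT => no.
  have [|m Hm] := allbad 0 (T 0); first by move=> a _ da; apply: no; exists a.
  case E : (T (m + 0)) (T0 (m + 0)) => [//|w s] _.
  have wT : w \in T (m + 0) by rewrite E mem_head.
  exact: (Hm _ (ancT _ _ _ wT) _ wT erefl).
have [|nx nxP] := @choice (nat * A)%type A (fun p v' => deep p.1 p.2 ->
    deep p.1.+1 v' /\ f p.1 v' = p.2).
  move=> [d v] /=; have [dv|nd] := pselect (deep d v); last by exists v.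
  by have [v' dv' fv'] := deepS d v dv; exists v'.
pose t := fix t d := if d is e.+1 then nx (e, t e) else v0.
have td d : deep d (t d) by elim: d => //= d /(nxP (_, _)) [].
by exists t => d; split; [exact: deepT | exact: (nxP (_, _) (td d)).2].
Qed.

(** * From proper constructions with bounded spacers to minimality *)

Section Limit.

Variables (n : nat) (S : nat -> seq word) (g : nat -> word -> building).
Variables (r : nat -> word) (V : nat -> bool).
Hypotheses (sch : scheme n S g r) (rV : limit_word r V).

Lemma root_mkseq i : r i = mkseq V (size (r i)).
Proof.
apply: (@eq_from_nth _ false) => [|k ki]; first by rewrite size_mkseq.
have [N _ HN] := rV k.
have /prefixP [s E] := root_prefix sch i N.
have := HN (N + i) (leq_addr _ _); rewrite E => /(onth_nth false).
by rewrite nth_cat ki nth_mkseq.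
Qed.

Lemma subword_root u : subword_inf u V <-> exists i, infix u (r i).
Proof.
rewrite subword_infP; split=> [[m um]|[i ui]]; last first.
  by exists (size (r i)); rewrite -root_mkseq.
exists m; apply: infix_trans um _; rewrite root_mkseq.
by apply: (mkseq_infix V (p := 0)); rewrite add0n ltnW // (root_size sch).
Qed.

Lemma infix_root i d : infix (r i) (r (d + i)).
Proof. exact/prefixW/(root_prefix sch). Qed.

Lemma proper_bounded_minimal M :
  (forall i v, v \in S i.+1 -> building_words (g i v) =i S i) ->
  (forall i v, v \in S i.+1 ->
    all (fun s => s <= M) (building_spacers (g i v))) ->
  minimal_subshift (word_subshift V).
Proof.
move=> prop bnd; apply: subword_minimal => x y u Vx Vy uy.
have /subword_root [i0 ui0] := Vy u uy.
(* One level above [r i0], properness puts [r i0], and with it [u], into every word. *)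
pose i := i0.+1; pose K := \max_(v <- S i) size v.
have uS v : v \in S i -> infix u v.
  move=> vS; apply: infix_trans ui0 _; rewrite -(build_value sch vS).
  by apply: building_word_infix; rewrite prop // (scheme_root sch).
pose L := (K.*2 + M).+1.
pose z : word := mkseq (fun k => x (k%:Z)%R) L.
have zx : subword_biinf z x.
  exists 0%R; rewrite size_mkseq; apply: eq_mkseq => k.
  by congr (x _); rewrite GRing.add0r.
apply: infix_subword_biinf (zx).
have /subword_root [j zj] := Vx _ zx.
(* A higher root also contains [z], and its level is at least [i], so it expands over [S i]. *)
have {zj} : infix z (r (j + i)).
  by apply: infix_trans zj _; rewrite addnC; apply: infix_root.
have rS := scheme_root sch (j + i).
rewrite -(expand_value sch rS).
set b := expand g i j _.
(* An empty spacer in front of the first word gives all blocks the same shape. *)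
have -> : building_value b =
    flatten [seq nseq p.1 true ++ p.2 | p <- (0, b.1) :: b.2] by [].
set l := _ :: _ => /infixP [s1 [s2 E]].
have -> : z = take L (drop (size s1)
    (flatten [seq nseq p.1 true ++ p.2 | p <- l])).
  by rewrite E drop_size_cat // take_size_cat // size_mkseq.
apply: blocks_window; last first.
  by rewrite E !size_cat size_mkseq leq_add2l leq_addr.
have bS v : v \in building_words b -> (size v <= K) && infix u v.
  move=> vb; have vS : v \in S i := expand_sub sch rS vb.
  by rewrite uS // andbT /K (big_rem _ vS) leq_maxl.
have bM : all (fun s => s <= M) (building_spacers b).
  exact: (expand_spacers sch bnd).
rewrite /= bS ?mem_head //=; apply/allP => p pb.
rewrite bS ?andbT; last by rewrite inE (map_f snd pb) orbT.
exact: (allP bM _ (map_f fst pb)).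
Qed.

Lemma infix_level_subword i d v :
  v \in building_words (expand g i d (r (d + i))) -> subword_inf v V.
Proof.
move=> vr; apply/subword_root; exists (d + i).
rewrite -(expand_value sch (scheme_root sch (d + i))).
exact: building_word_infix.
Qed.

End Limit.

(** * From minimality to levels that use all earlier words *)

Section Reduction.

Variables (n : nat) (S : nat -> seq word) (g : nat -> word -> building).
Variables (r : nat -> word) (V : nat -> bool).
Hypotheses (sch : scheme n S g r) (rV : limit_word r V).

(** Such words are subwords of [V], which an arbitrary word of a level need not be. *)
Definition used i v : Prop :=
  exists d, v \in building_words (expand g i d (r (d + i))).

Lemma used_build i v u :
  used i.+1 v -> u \in building_words (g i v) -> used i u.
Proof.
case=> d vd uv; exists d.+1; apply/mem_expandSr; exists v => //.
by rewrite addSnnS.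
Qed.

Lemma used_scheme :
  scheme n (fun i => [seq v <- S i | `[< used i v >]]) g r.
Proof.
split=> [i|i|v|i v|i].
- by apply: leq_trans (scheme_size sch i); rewrite size_filter count_size.
- rewrite mem_filter (scheme_root sch) andbT; apply/asboolP.
  by exists 0; rewrite inE.
- by rewrite mem_filter => /andP [_ /(scheme_zero sch)].
- rewrite mem_filter => /andP [/asboolP uv vS].
  have [F vF b2 sub E] := scheme_build sch vS; split=> //.
    by apply/allP => w; rewrite mem_filter => /andP [_ /(allP F)].
  move=> w wv; rewrite mem_filter sub // andbT; apply/asboolP.
  exact: used_build uv wv.
- exact: (scheme_first sch).
Qed.

Hypothesis all_used : forall i v, v \in S i -> used i v.

(** A longer spacer would lie inside a used word and so put [M.+1] consecutive ones into [V]. *)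
Lemma level_spacers M : ~ subword_inf (nseq M.+1 true) V ->
  forall i d v, v \in S (d + i) ->
  all (fun s => s <= M) (building_spacers (expand g i d v)).
Proof.
move=> nM i d v vS; apply/allP => s sv; rewrite leqNgt; apply/negP => Ms.
apply: nM; have [e /(infix_level_subword sch rV) vV] := all_used vS.
apply: infix_subword_inf vV; apply: infix_trans (_ : infix (nseq s true) v).
  apply/infixP; exists [::], (nseq (s - M.+1) true).
  by rewrite cat0s -nseqD subnKC.
by rewrite -[X in infix _ X](expand_value sch vS); apply: building_spacer_infix.
Qed.

Variable X : set full_shift.
Hypotheses (hrank : symbolic_rank X n) (mX : minimal_subshift X).
Hypothesis (XV : X = word_subshift V).

Lemma eventually_used i u : u \in S i -> exists d, forall v, v \in S (d + i) ->
  u \in building_words (expand g i d v).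
Proof.
move=> uS; apply: contrapT => no.
(* The words [d] levels up that avoid [u]; by [Tsub] below they are built from one another. *)
pose T d := [seq v <- S (d + i) | u \notin building_words (expand g i d v)].
have T0 d : T d != [::].
  apply/eqP => Td; apply: no; exists d => v vS; apply: contraT => uv.
  by have : v \in T d; [rewrite mem_filter uv | rewrite Td].
have Tsub d v p :
    v \in T d.+1 -> p \in building_words (g (d + i) v) -> p \in T d.
  rewrite mem_filter => /andP [uv vS] pv.
  rewrite mem_filter (build_sub sch vS pv) andbT.
  by apply: contra uv => up; apply/mem_expandS; exists p.
have [d0 ud0] := all_used uS.
(* From [d0] levels up the root uses [u], so [T] misses it and has fewer than [n] words. *)
have rT k : r (k + d0 + i) \notin T (k + d0).
  rewrite mem_filter (scheme_root sch) andbT negbK.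
  elim: k => // k IH; apply/mem_expandS; exists (r (k + d0 + i)) => //.
  by rewrite -(scheme_first sch (k + d0 + i)) mem_head.
have Tn k : size (T (k + d0)) < n.
  apply: leq_trans (scheme_size sch (k + d0 + i)).
  rewrite size_filter ltn_neqAle count_size andbT -all_count.
  apply/negP => /allP /(_ _ (scheme_root sch _)) H.
  by have := rT k; rewrite mem_filter H (scheme_root sch).
(* With the first word of the building as parent, an infinite branch is a sequence of roots as
   [scheme_first] requires. *)
have [||t tP] := @konig word (fun k => T (k + d0).+1)
    (fun k v => (g ((k + d0).+1 + i) v).1).
- by move=> k; apply: T0.
- by move=> k v vT; apply: Tsub vT _; rewrite mem_head.
have tS k : t k \in S ((k + d0).+1 + i).
  by have [+ _] := tP k; rewrite mem_filter => /andP [].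
(* Level 0 may contain only the word 0, so [g' 0] expands the first avoiding words all the way down
   to it; the [.+1] keeps that depth positive, as a building requires. *)
pose S' k := if k is e.+1 then T (e + d0).+1 else [:: [:: false]].
pose g' k := if k is e.+1 then g ((e + d0).+1 + i) else expand g 0 (d0.+1 + i).
pose r' k := if k is e.+1 then t e else [:: false].
have TF k : all in_F (T k).
  apply/allP => v; rewrite mem_filter => /andP [_].
  exact: (scheme_in_F sch).
have sch' : scheme n.-1 S' g' r'.
  split.
  - case=> [|k] /=.
      have := Tn 0; have := T0 (0 + d0); rewrite -size_eq0.
      by case: (size _) => // m _; case: n => // -[].
    have := Tn k.+1; rewrite addSn; case: n => //.
  - by case=> [|k]; [rewrite inE | case: (tP k)].
  - by move=> v; rewrite inE => /eqP.
  - case=> [|k] v vT.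
      have vS : v \in S (d0.+1 + i + 0).
        by move: vT; rewrite addn0 mem_filter => /andP [].
      have [F vF b2 sub E] := expand_building sch (ltn0Sn _) vS.
      split=> // w /sub /(scheme_zero sch) ->; exact: mem_head.
    have vS : v \in S ((k + d0).+1 + i).+1.
      by move: vT; rewrite mem_filter => /andP [].
    have [F vF b2 sub E] := scheme_build sch vS.
    by split=> //; [apply: TF | move=> w wv; apply: Tsub vT wv].
  - case=> [|k] /=; last by case: (tP k).
    apply: (scheme_zero sch).
    apply: (expand_sub sch (v := t 0) (d := d0.+1 + i)).
      by rewrite addn0; apply: tS.
    exact: mem_head.
have [W r'W] := scheme_limit sch'.
have WV w : subword_inf w W -> subword_inf w V.
  case/(subword_root sch' r'W) => k wk; apply: infix_subword_inf wk _.
  have tV e : subword_inf (t e) V.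
    by have [c /(infix_level_subword sch rV)] := all_used (tS e).
  case: k => [|k] //=; apply: infix_subword_inf (tV 0).
  exact: infix_root sch' 0 1.
have [x Wx] := word_subshift_nonempty W.
have Xx : X x by rewrite XV => w /Wx /WV.
(* By minimality every word of a point of [X] occurs in [x], hence in [W]. *)
have XW : X = word_subshift W.
  rewrite eqEsubset; split=> y Xy.
    by move=> w wy; apply: Wx; apply: minimal_subword mX Xx Xy wy.
  by rewrite XV => w /Xy /WV.
have [C [rC _ C1 _]] := scheme_construction sch'.
(* [S' 0] has one word; so [n.-1] is a positive rank realizing [X], against the choice of [n]. *)
have n1 : 0 < n.-1.
  by have := scheme_size sch' 0; case: (n.-1).
suff : n <= n.-1 by lia.
case: hrank => _ _; apply=> //; exists W => //; exists C => // m.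
by have [N _ HN] := r'W m; exists N => // k /HN; rewrite C1.
Qed.

(** The depths found for the finitely many words of [S i] are added up; using a given word passes
    upward through the first word of each building. *)
Lemma eventually_all_used i : exists2 d, 0 < d & forall v, v \in S (d + i) ->
  building_words (expand g i d v) =i S i.
Proof.
have up u d :
    (forall v, v \in S (d + i) -> u \in building_words (expand g i d v)) ->
    forall k v, v \in S (k + d + i) ->
    u \in building_words (expand g i (k + d) v).
  move=> H; elim=> // k IH v vS; apply/mem_expandS.
  exists (g (k + d + i) v).1; first exact: mem_head.
  by apply: IH; apply: (build_sub sch vS); apply: mem_head.
have [d Hd] : exists d, forall v, v \in S (d + i) ->
    {subset S i <= building_words (expand g i d v)}.
  have : {subset S i <= S i} by [].
  elim: {1 3}(S i) => [|u s IH] sub; first by exists 0.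
  have [|d Hd] := IH; first by move=> v vs; apply: sub; rewrite inE vs orbT.
  have [e He] := eventually_used (sub u (mem_head _ _)).
  exists (e + d) => v vS w; rewrite inE => /orP [/eqP ->|ws].
    by move: vS; rewrite (addnC e d); apply: up.
  by apply: up => // p pS; apply: Hd.
(* The extra level makes the depth positive. *)
exists d.+1 => // v vS u; apply/idP/idP; first exact: expand_sub sch _ _ _ vS _.
move=> uS; have := up u d (fun p pS => Hd p pS u uS) 1 v.
by apply.
Qed.

End Reduction.

(** * Bounded spacers, selection of levels, and the equivalences *)

(** Otherwise [X] contains the constant sequence 1, and by minimality every letter of every point of
    [X] is 1, so [X] is finite. *)
Lemma no_long_ones X V : infinite_set X -> minimal_subshift X ->
  X = word_subshift V -> exists M, ~ subword_inf (nseq M.+1 true) V.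
Proof.
move=> Xinf mX XV; apply: contrapT => no; apply: Xinf.
pose one : full_shift := fun=> true.
have onesE m : nseq m true = mkseq (fun=> true) m.
  apply: (@eq_from_nth _ false) => [|k]; rewrite size_nseq ?size_mkseq // => km.
  by rewrite nth_nseq km nth_mkseq.
have X1 : X one.
  rewrite XV => u [a ->]; rewrite -onesE.
  have [ones|nones] := pselect (subword_inf (nseq (size u).+1 true) V).
    apply: infix_subword_inf ones; apply/infixP; exists [::], [:: true].
    by rewrite -(nseqD _ 1) addn1.
  by case: no; exists (size u).
apply: (@sub_finite_set _ _ [set one]); last exact: finite_set1.
move=> y Xy; apply/funext => a.
have [|b] := minimal_subword (u := [:: y a]) mX X1 Xy.
  by exists a; rewrite /=; congr [:: y _]; lia.
by case.
Qed.

Lemma minimal_proper_bounded n X V : infinite_set X -> symbolic_rank X n ->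
  minimal_subshift X -> X = word_subshift V -> has_rank_construction n V ->
  has_proper_bounded_construction n V.
Proof.
move=> Xinf hrank mX XV [C0 /construction_scheme sch0 C0V].
have [M HM] := no_long_ones Xinf mX XV.
have := used_scheme sch0; set S := fun i => _; set g := word_build C0.
set r := cword C0 ^~ 1 => sch.
have us i v : v \in S i -> used g r i v.
  by rewrite mem_filter => /andP [/asboolP].
have [|K HK] := @choice nat nat (fun i d => 0 < d /\
    forall v, v \in S (d + i) ->
    building_words (expand g i d v) =i S i).
  move=> i; have [d d0 Hd] := eventually_all_used sch C0V us hrank mX XV i.
  by exists d.
(* Only the levels [lv m] are kept; each word of one kept level uses all words of the kept level
   before it. *)
pose lv := fix lv m := if m is k.+1 then K (lv k) + lv k else 0.
have lvm m : m <= lv m.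
  by elim: m => //= m IH; have [] := HK (lv m); lia.
have sch' : scheme n (S \o lv) (fun m => expand g (lv m) (K (lv m))) (r \o lv).
  split=> [m|m|v|m v vS|m] /=.
  - exact: scheme_size sch _.
  - exact: scheme_root sch _.
  - exact: scheme_zero sch _.
  - by apply: (expand_building sch) vS; have [] := HK (lv m).
  - exact: expand_first sch _ _.
have [C [rC pC C1 CB]] := scheme_construction sch'.
exists C; split=> //.
- move=> m; have [N _ HN] := C0V m; exists N => // k /= Nk.
  by rewrite C1; apply: HN; apply: leq_trans Nk (lvm k).
- by apply/pC => m v vS; apply: (HK (lv m)).2.
- exists M.+1 => // i j /CB [v vS ->].
  apply: sub_all (level_spacers sch C0V us HM vS).
  by move=> s /=; apply: leqW.
Qed.

Lemma has_proper_bounded_construction_minimal n V :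
  has_proper_bounded_construction n V -> minimal_subshift (word_subshift V).
Proof.
move=> [C [rC CV [Cn pC] [M _ bC]]]; have sch := construction_scheme rC.
apply: (proper_bounded_minimal sch CV (M := M)) => i v vS.
  by have [j1 _] := mem_levelP vS; apply: pC; rewrite -(Cn i.+1).
by have [j1 _] := mem_levelP vS; apply: bC.
Qed.

Theorem corollary5p4 (n : nat) (hn : 1 <= n) (X : set full_shift)
  (hX : subshift X) (hinf : infinite_set X) (hrank : symbolic_rank X n) :
  (minimal_subshift X <->
    exists V, [/\ rank_word n V, X = word_subshift V
                & has_proper_bounded_construction n V])
  /\
  (minimal_subshift X <->
    forall V, rank_word n V -> X = word_subshift V ->
      has_proper_bounded_construction n V).
Proof.
(* Any [V] realizing the symbolic rank is a rank-[n] word: levels are nonempty, so a rank-[n.-1]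
   construction has [0 < n.-1] and would lower the rank of [X]. *)
have [V0 rV0 XV0] : exists2 V, rank_word n V & X = word_subshift V.
  have [_ [V nV XV] min] := hrank; exists V => //; split=> // n1V.
  have n1 : 0 < n.-1 by have [C [nC _ _ _] _] := n1V; have := nC 0; lia.
  by have := min n.-1 n1 (ex_intro2 _ _ V n1V XV); lia.
have to3 : minimal_subshift X -> forall V, rank_word n V ->
    X = word_subshift V -> has_proper_bounded_construction n V.
  move=> mX V [nV _] XV.
  exact: minimal_proper_bounded hinf hrank mX XV nV.
have to1 V : X = word_subshift V -> has_proper_bounded_construction n V ->
    minimal_subshift X.
  by move=> -> /has_proper_bounded_construction_minimal.
split; split.
- by move=> mX; exists V0; split=> //; apply: to3.
- by move=> [V [_ XV pV]]; apply: to1 pV.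
- exact: to3.
(* Condition (3) is not vacuous, thanks to [V0]. *)
- by move=> H; apply: to1 XV0 (H _ rV0 XV0).
Qed.
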